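(* (1) If $n\ge 4$, then the number of matrices in $\mathcal{PSC}_n^{0,0}$ with exponent $2n-4$ is $2$. (2) If $n\ge 5$, then the number $N_n^{0,0}(4)$ of matrices in $\mathcal{PSC}_n^{0,0}$ with exponent $4$ satisfies $$2\sum_{q=0}^{\lfloor\frac{n+1}{3}\rfloor}\binom{n-2q-4}{q}\ \le\ N_n^{0,0}(4)\ \le\ 2\left[\sum_{q=1}^{\lfloor\frac{2n-7}{5}\rfloor}F_{n-5}(q,1)+\sum_{q=2}^{\lfloor\frac{2n+2}{3}\rfloor}F_{n-5}(q,2)+1\right].$$
   Context: For $n\ge 3$, let $C_n$ be the set of $n\times n$ real matrices $A$ whose row $i$ ($1\le i\le n-1$) has a single entry $1$ in column $i+1$ and zeros elsewhere, and whose last row has all entries in $\{0,1\}$. For $A\in C_n$ put $F(A)=A+A^T$. Let $C_n^{0,0}=\{F(A): A\in C_n,\ a_{n,1}=0,\ a_{n,n}=0\}$ and $\mathcal{PSC}_n^{0,0}$ the set of primitive matrices in it; a nonnegative matrix is primitive if some power is entrywise positive, and its exponent is the least such power. $F_m(q,k)$ is the number of binary strings of length $m$ with exactly $q$ zeros whose longest run of consecutive zeros has length exactly $k$ ($F_m(q,k)=0$ if $m<0$). The binomial coefficient $\binom{a}{q}$ is taken to be $0$ when $a<q$ (in particular when $a<0$). *)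

(* Defs.v *)
From mathcomp Require Import all_boot all_order all_algebra finmap.
From mathcomp Require Import classical_sets cardinality reals.
Set Implicit Arguments.
Unset Strict Implicit.
Unset Printing Implicit Defensive.

Import Order.TTheory GRing.Theory Num.Theory.
Local Open Scope classical_set_scope.
Local Open Scope ring_scope.

(* Indices are 0-based: the mathematical row/column i is the ordinal of value
   i - 1, and the last row is the one with [i.+1 = n]. *)
Definition companion01 (R : realType) (n : nat) : set 'M[R]_n :=
  [set A | forall i j : 'I_n,
     if (i.+1 < n)%N then A i j = (nat_of_ord j == i.+1)%:R
     else A i j = 0 \/ A i j = 1].

Definition sym_companion (R : realType) (n : nat) (A : 'M[R]_n) : 'M[R]_n :=
  A + A^T.

(* The two conditions are a_{n,1} = 0 and a_{n,n} = 0. *)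
Definition sym_companion00 (R : realType) (n : nat) : set 'M[R]_n :=
  [set sym_companion A | A in
     [set A : 'M[R]_n | companion01 A
        /\ (forall i j : 'I_n, i.+1 = n -> nat_of_ord j = 0%N -> A i j = 0)
        /\ (forall i : 'I_n, i.+1 = n -> A i i = 0)]].

Definition nonneg_mx (R : realType) (n : nat) (M : 'M[R]_n) : Prop :=
  forall i j, 0 <= M i j.

Definition pos_mx (R : realType) (n : nat) (M : 'M[R]_n) : Prop :=
  forall i j, 0 < M i j.

Definition primitive_mx (R : realType) (n : nat) (M : 'M[R]_n) : Prop :=
  nonneg_mx M /\ exists k : nat, (0 < k)%N /\ pos_mx (M ^+ k).

Definition has_exponent (R : realType) (n : nat) (M : 'M[R]_n) (e : nat) : Prop :=
  [/\ (0 < e)%N, pos_mx (M ^+ e)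
    & forall k : nat, (0 < k)%N -> pos_mx (M ^+ k) -> (e <= k)%N].

Definition PSC00 (R : realType) (n : nat) : set 'M[R]_n :=
  [set M | sym_companion00 M /\ primitive_mx M].

(* [fset_set S] is empty when S is infinite. The set below is finite: see
   [finite_PSC00_exponent]. *)
Definition num_PSC00 (R : realType) (n e : nat) : nat :=
  #|` fset_set [set M : 'M[R]_n | PSC00 M /\ has_exponent M e]|.

(* In a binary string, [false] is the digit 0. *)
Definition longest_zero_run (s : seq bool) : nat :=
  \max_(k < (size s).+1 | infix (nseq k false) s) k.

Definition zero_run_strings (m q k : nat) : nat :=
  #|[pred s : m.-tuple bool | (count_mem false s == q)
                              && (longest_zero_run s == k)]|.

Lemma finite_companion01 (R : realType) (n : nat) :
  finite_set (@companion01 R n).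
Proof.
pose f (b : {ffun 'I_n * 'I_n -> bool}) : 'M[R]_n :=
  \matrix_(i, j) (b (i, j))%:R.
apply: (sub_finite_set (B := f @` setT)); last first.
  by apply: finite_image; exact: finite_finset.
move=> A CA; exists [ffun p => A p.1 p.2 == 1] => //.
apply/matrixP => i j; rewrite mxE ffunE /=.
have natb (b : bool) : (b%:R == 1 :> R) = b.
  by case: b; rewrite ?eqxx // eq_sym oner_eq0.
have := CA i j; case: ifP => _ => [->|[->|->]].
- by rewrite natb.
- by rewrite (natb false).
- by rewrite eqxx.
Qed.

Lemma finite_PSC00_exponent (R : realType) (n e : nat) :
  finite_set [set M : 'M[R]_n | PSC00 M /\ has_exponent M e].
Proof.
apply: (sub_finite_set (B := @sym_companion R n @` @companion01 R n)).
  by move=> M [[[A [CA _] <-] _] _]; exists A.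
exact: finite_image (@finite_companion01 R n).
Qed.

(* Main.v *)
Require Import Defs.
From mathcomp Require Import all_boot all_order all_algebra finmap.
From mathcomp Require Import classical_sets cardinality reals.
From mathcomp Require Import boolp zify.

Set Implicit Arguments.
Unset Strict Implicit.
Unset Printing Implicit Defensive.

Import Order.TTheory GRing.Theory Num.Theory.

(* With 0-based vertices, the graph of F(A) is the path 0, ..., n-1 together
   with chords from the hub n-1 to the j <= n-3 with a_{n,j+1} = 1; the entry
   a_{n,n-1} only changes the weight of a path edge, so all counts are even.
   - A walk between u and v of the parity of u + v exists for every length
     >= |u - v|.  For the other parity use a chord j with j = n-1 mod 2, which
     exists iff the graph is not bipartite: if j <= n-5, or if there is a second
     chord, all lengths from 2n-5 on are reached.  If n-3 is the only chord, a
     closed odd walk at 0 must travel to the triangle and back, so it has length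
     >= 2n-3, and the exponent is 2n-4.
   - The exponent is 4 iff all pairs are joined by walks of length 4.  This
     forces chords at 1 and 2, forbids 000 on the positions 3, ..., n-3, and
     forbids 01010 on the string continued by the digit 1 of n-2 and a digit 0
     for the hub; without 00 the latter gives at least 3 ones for 2 zeros.
     Conversely it suffices that every vertex has a walk of length 2 to the
     hub, which holds if positions 3, ..., n-2 are a
     concatenation of blocks 1 and 011. *)

(** * Walks on a path with chords at its last vertex *)

Definition adj (n : nat) (S : pred nat) (u v : nat) : bool :=
  [&& u < n, v < n &
      [|| v == u.+1, u == v.+1, (u.+1 == n) && S v | (v.+1 == n) && S u]].

Fixpoint walk (n : nat) (S : pred nat) (k u v : nat) : Prop :=
  if k is k'.+1 then exists2 w, walk n S k' u w & adj n S w v else u = v.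

Definition all_walks (n : nat) (S : pred nat) (k : nat) : Prop :=
  forall u v, u < n -> v < n -> walk n S k u v.

Definition walk_exponent (n : nat) (S : pred nat) (e : nat) : Prop :=
  [/\ 0 < e, all_walks n S e
    & forall k, 0 < k -> all_walks n S k -> e <= k].

(** The bounds encode a_{n,1} = a_{n,n} = 0; [n - 2] is left out because the path already joins it
    to the hub. *)
Definition chords_in (n : nat) (S : pred nat) : Prop :=
  forall j, S j -> 0 < j /\ j + 2 < n.

Section Walks.
Variables (n : nat) (S : pred nat).
Local Notation W := (walk n S).

Lemma adj_sym u v : adj n S u v -> adj n S v u.
Proof.
by case/and3P=> hu hv; rewrite /adj hu hv /=; case/or4P=> ->; rewrite ?orbT.
Qed.

Lemma adj_step u : u.+1 < n -> adj n S u u.+1.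
Proof. by move=> h; rewrite /adj h eqxx (ltnW h). Qed.

Lemma adj_chord j : S j -> j < n -> adj n S n.-1 j.
Proof. by case: n => // n' Sj jn; rewrite /adj jn ltnSn eqxx Sj !orbT. Qed.

Lemma walk_cat k l u v w : W k u v -> W l v w -> W (k + l) u w.
Proof.
move=> kuv; elim: l w => [w <-|l IH w [x lvx xw]]; first by rewrite addn0.
by rewrite addnS; exists x; [exact: IH|].
Qed.

Lemma walk1 u v : adj n S u v -> W 1 u v.
Proof. by exists u. Qed.

Lemma walk_sym k u v : W k u v -> W k v u.
Proof.
elim: k u v => [u v -> //|k IH u v [w kuw wv]].
by rewrite -add1n; apply: (walk_cat (walk1 (adj_sym wv))); exact: IH.
Qed.

Lemma walk_line u d : u + d < n -> W d u (u + d).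
Proof.
elim: d => [|d IH] h; first by rewrite addn0.
exists (u + d); first by apply: IH; lia.
by rewrite addnS; apply: adj_step; lia.
Qed.

Lemma walk_pad k t u v : 1 < n -> v < n -> W k u v -> W (k + t.*2) u v.
Proof.
move=> n1 vn; elim: t k => [k|t IH k kuv]; first by rewrite addn0.
have -> : k + t.+1.*2 = (k + 2) + t.*2 by lia.
apply: IH; apply: (walk_cat kuv).
case: (ltnP v.+1 n) => h.
  by exists v.+1; [apply: walk1; exact: adj_step|apply/adj_sym/adj_step].
case: v vn h {kuv} => [|v] vn h; first by lia.
exists v; last exact: adj_step.
by apply/walk1/adj_sym/adj_step.
Qed.

Lemma walk_pad_le k l u v :
  1 < n -> v < n -> k <= l -> odd k = odd l -> W k u v -> W l u v.
Proof.
move=> n1 vn kl okl kuv; have -> : l = k + (l - k)./2.*2 by lia.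
exact: walk_pad.
Qed.

Lemma walk_parity k u v :
  1 < n -> u < n -> v < n -> n.-1 <= k -> odd k = odd (u + v) -> W k u v.
Proof.
move=> n1; wlog uv : u v / u <= v => [hw hu hv kn ok|hu hv kn ok].
  case: (leqP u v) => uv; first exact: hw.
  by apply: walk_sym; apply: hw => //; [exact: ltnW|rewrite addnC].
apply: (@walk_pad_le (v - u)) => //; [lia|lia|].
by rewrite -{2}(subnKC uv); apply: walk_line; lia.
Qed.

Lemma walk_below u v : u <= v -> v < n -> W (v - u) u v.
Proof. by move=> uv vn; rewrite -{2}(subnKC uv); apply: walk_line; lia. Qed.

Lemma walk_dist u v : u < n -> v < n -> W ((u - v) + (v - u)) u v.
Proof.
move=> hu hv; case: (leqP u v) => uv.
  by have -> : u - v + (v - u) = v - u by [lia]; exact: walk_below.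
have -> : u - v + (v - u) = u - v by lia.
by apply/walk_sym/walk_below => //; exact: ltnW.
Qed.

(** From [u] along the path to [j], over the chord, then down from the hub to [v]. If [j] has the
    parity of [n.-1], the length has the parity opposite to [u + v]. *)
Lemma walk_via_chord j u v : j < n -> u < n -> v < n -> S j ->
  W (((u - j) + (j - u)) + 1 + (n.-1 - v)) u v.
Proof.
move=> jn un vn Sj; apply: (@walk_cat _ _ _ n.-1); last first.
  by apply/walk_sym/walk_below; lia.
apply: (@walk_cat _ _ _ j); first exact: walk_dist.
by apply/walk1/adj_sym/adj_chord.
Qed.

Hypothesis Sn : chords_in n S.

(* A chord [j] closes an odd cycle exactly when [j] and [n.-1] have the same
   parity; otherwise the parity of the vertex number is a 2-colouring. *)
Lemma all_walks_odd_chord k : 1 < n -> all_walks n S k ->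
  exists2 j, S j & odd j = odd n.-1.
Proof.
move=> n1 Wk.
case: (pselect (exists2 j, S j & odd j = odd n.-1)) => // noj.
have col l u v : W l u v -> odd v = odd (u + l).
  elim: l v => [v <-|l IH v [w /IH ow]]; first by rewrite addn0.
  case/and3P=> _ _ /or4P[/eqP|/eqP|/andP[/eqP e Sv]|/andP[/eqP e Sw]]; try lia.
  - by have : odd v <> odd n.-1 by [move=> ov; apply: noj; exists v]; lia.
  - by have : odd w <> odd n.-1 by [move=> ov; apply: noj; exists w]; lia.
(* Walks of the same length [k] from 0 to both 0 and 1 contradict the colouring. *)
have := col _ _ _ (Wk 0 0 (ltnW n1) (ltnW n1)).
have := col _ _ _ (Wk 0 1 (ltnW n1) n1); lia.
Qed.

(* The graph is then a triangle with a tail of length [n - 3]. *)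
Definition last_chord_only : Prop := S (n - 3) /\ forall j, S j -> j = n - 3.

Lemma all_walks_pred k : 4 <= n -> all_walks n S k -> ~ last_chord_only ->
  all_walks n S (2 * n - 5).
Proof.
move=> n4 Wk nlast u v.
wlog uv : u v / u <= v => [hw hu hv|hu hv].
  case: (leqP u v) => uv; first exact: hw.
  by apply: walk_sym; apply: hw => //; exact: ltnW.
case opar: (odd (u + v)); first by apply: walk_parity; lia.
have [j Sj oj] := all_walks_odd_chord (ltac:(lia) : 1 < n) Wk.
have [j0 jn] := Sn Sj.
have [jn5|jn5] := leqP (j + 5) n.
  apply: (walk_pad_le _ _ _ _ (walk_via_chord _ hu hv Sj)); lia.
have ej : j = n - 3 by lia.
(* For [u <= n - 3] the walk via [j] has length [2 * n - 3 - (u + v)]. As [u + v] is even, only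
   [u = v = 0] needs another chord. *)
have [uv0|uv0] := posnP (u + v); last first.
  apply: (walk_pad_le _ _ _ _ (walk_via_chord _ hu hv Sj)); lia.
have [-> ->] : u = 0 /\ v = 0 by lia.
have [j' Sj' j'n] : exists2 j', S j' & j' <> n - 3.
  case: (pselect (exists2 j', S j' & j' <> n - 3)) => // noj; case: nlast.
  split=> [|j' Sj']; first by rewrite -ej.
  by case: (eqVneq j' (n - 3)) => // /eqP ne; case: noj; exists j'.
have [j'0 j'n'] := Sn Sj'.
case oj' : (odd (n.-1 + j')); last first.
  have := @walk_via_chord j' 0 0 (ltac:(lia)) (ltac:(lia)) (ltac:(lia)) Sj'.
  by apply: walk_pad_le; lia.
(* Reaching the hub through [j'] and returning through [j] gives a closed walk of odd length
   [j' + n - 1], where [j' <= n - 4]. *)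
have w1 := @walk_via_chord j' 0 n.-1 (ltac:(lia)) (ltac:(lia)) (ltac:(lia)) Sj'.
have w2 := walk_sym
  (@walk_via_chord j 0 n.-1 (ltac:(lia)) (ltac:(lia)) (ltac:(lia)) Sj).
by apply: walk_pad_le (walk_cat w1 w2); lia.
Qed.

(** The parity of [k + v] changes only at the chord, and right after its first use
    [k + v >= 2 * n - 3]. Later this sum drops only on the way from the hub to [n - 3], by 1; if
    that breaks the bound, the first alternative holds again. *)
Lemma last_chord_walk_bound k v : 4 <= n -> last_chord_only -> W k 0 v ->
  (odd k = odd v /\ v <= k) \/ 2 * n <= k + v + 3.
Proof.
move=> n4 [Sl Slast]; elim: k v => [v <-|k IH v [w /IH hw]]; first by left.
case/and3P=> wn vn /or4P[/eqP|/eqP|/andP[/eqP e /Slast]|/andP[/eqP e /Slast]];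
  lia.
Qed.

Lemma walk_exponent_last : 4 <= n -> last_chord_only ->
  walk_exponent n S (2 * n - 4).
Proof.
move=> n4 hl; split=> [|u v|k k0 Wk]; first by lia.
- wlog uv : u v / u <= v => [hw hu hv|hu hv].
    case: (leqP u v) => uv; first exact: hw.
    by apply: walk_sym; apply: hw => //; exact: ltnW.
  case opar: (odd (u + v)); last by apply: walk_parity; lia.
  apply: (walk_pad_le _ _ _ _ (walk_via_chord _ hu hv hl.1)); lia.
(* The pair 0, 0 forces [2 * n - 3 <= k] for odd [k], and the pair 0, 1 forces [2 * n - 4 <= k] for
   even [k]. *)
- have := last_chord_walk_bound n4 hl (Wk 0 0 ltac:(lia) ltac:(lia)).
  have := last_chord_walk_bound n4 hl (Wk 0 1 ltac:(lia) ltac:(lia)).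
  lia.
Qed.

Lemma walk_exponent_lastP : 4 <= n ->
  walk_exponent n S (2 * n - 4) <-> last_chord_only.
Proof.
move=> n4; split=> [[_ We emin]|]; last exact: walk_exponent_last.
case: (pselect last_chord_only) => // /(all_walks_pred n4 We).
by move/(emin (2 * n - 5) ltac:(lia)); lia.
Qed.

(** * Graphs of exponent 4 *)

Lemma walk_exponent4P : 5 <= n -> walk_exponent n S 4 <-> all_walks n S 4.
Proof.
move=> n5; split=> [[]//|W4]; split=> // k k0 Wk.
(* Vertex 0 has the sole neighbour 1, so lengths 1, 2, 3 fail on the pairs (0, 0), (0, 1), (0, 0):
   such a walk would need a loop at 0 or 1. *)
case: k k0 Wk => [//|[|[|[|k]]]] // _ Wk.
- have [w <-] := Wk 0 0 ltac:(lia) ltac:(lia).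
  by rewrite /adj; case/and3P=> _ _; lia.
- have adj0 w : adj n S 0 w -> w = 1.
    case/and3P=> _ _ /or4P[/eqP|/eqP|/andP[/eqP]|/andP[_ /Sn[]]] //; lia.
  have [w [_ <- /adj0 ->]] := Wk 0 1 ltac:(lia) ltac:(lia).
  by case/and3P=> _ _; lia.
- have adj0 w : adj n S 0 w -> w = 1.
    case/and3P=> _ _ /or4P[/eqP|/eqP|/andP[/eqP]|/andP[_ /Sn[]]] //; lia.
  have [w [x [_ <- /adj0 ->]]] := Wk 0 0 ltac:(lia) ltac:(lia).
  move=> h /adj_sym /adj0 ew; move: h; rewrite ew.
  by case/and3P=> _ _; lia.
Qed.

(* The second disjunct is the last edge of the path. *)
Definition spoke v : bool := S v || (v.+2 == n).

Lemma adj_hub v : adj n S n.-1 v -> spoke v.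
Proof.
rewrite /adj /spoke => /and3P[un vn /or4P[/eqP|/eqP|/andP[_ ->]|/andP[h Sn1]]] //.
- by lia.
- by move=> e; apply/orP; right; lia.
- by have := Sn Sn1; lia.
Qed.

Lemma spoke_adj v : 1 < n -> spoke v -> adj n S n.-1 v.
Proof.
move=> n1 /orP[Sv|/eqP e]; first by apply: adj_chord => //; have := Sn Sv; lia.
by rewrite /adj; apply/and3P; split; lia.
Qed.

Lemma adj_nonhub u v : u.+1 < n -> adj n S u v ->
  [\/ v = u.+1, u = v.+1 | v = n.-1 /\ spoke u].
Proof.
move=> un /and3P[_ vn /or4P[/eqP|/eqP|/andP[/eqP]|/andP[/eqP e Su]]] //.
- by constructor 1.
- by constructor 2.
- by lia.
- by constructor 3; rewrite /spoke Su; lia.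
Qed.

Lemma all_walks4 : 1 < n ->
  (forall v, v.+1 < n -> spoke v.+1 \/ (0 < v /\ spoke v.-1)) -> all_walks n S 4.
Proof.
move=> n1 hX.
have toh v : v < n -> W 2 v n.-1.
  move=> vn; case: (ltnP v.+1 n) => hv.
    have [sv|[v0 sv]] := hX v hv.
      by exists v.+1; [exact/walk1/adj_step|exact/adj_sym/spoke_adj].
    exists v.-1; last exact/adj_sym/spoke_adj.
    by apply/walk1/adj_sym; case: (v) v0 vn => // v' _ vn /=; exact: adj_step.
  have -> : v = n.-1 by lia.
  by apply: walk_sym; exists n.-2; [apply/walk1/spoke_adj => //|
     apply/adj_sym/spoke_adj => //]; rewrite /spoke; apply/orP; right; lia.
by move=> u v un vn; apply: (walk_cat (toh u un)); apply/walk_sym/toh.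
Qed.

Lemma walk4_mid u v : W 4 u v ->
  exists w x y, [/\ adj n S u x, adj n S x w, adj n S v y & adj n S y w].
Proof.
move=> [y [w [x [_ <- ux] xw] wy] yv].
by exists w, x, y; split=> //; exact: adj_sym.
Qed.

(** A walk of length 4 from 0 to 1 has the wrong parity for the path, so it visits the hub; there is
    time for this only around a triangle formed by 1, 2 and the hub. *)
Lemma all_walks4_start : 5 <= n -> all_walks n S 4 -> S 1 && S 2.
Proof.
move=> n5 W4.
have nS0 : ~~ spoke 0 by rewrite /spoke negb_or; apply/andP; split;
  [apply/negP => /Sn; lia | lia].
have s1 : spoke 1 -> S 1 by rewrite /spoke; case/orP=> //; lia.
have s2 : spoke 2 -> S 2 by rewrite /spoke; case/orP=> //; lia.
have [w [x [y [ux xw vy yw]]]] := walk4_mid (W4 0 1 ltac:(lia) ltac:(lia)).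
have ex : x = 1.
  by case: (adj_nonhub (ltac:(lia) : 1 < n) ux) => [//|//|[_ s0]]; rewrite s0 in nS0.
rewrite {}ex {ux x} in xw.
case: (adj_nonhub (ltac:(lia) : 2 < n) xw) => [ew|[ew]|[ew sp1]]; subst w.
- case: (adj_nonhub (ltac:(lia) : 2 < n) vy) => [ey|[ey]|[ey sp1]]; subst y.
  + by move: yw => /and3P[_ _]; lia.
  + by move: yw => /and3P[_ _]; lia.
  + by rewrite s1 //= s2 //; exact: adj_hub.
- case: (adj_nonhub (ltac:(lia) : 2 < n) vy) => [ey|[ey]|[ey sp1]]; subst y.
  + by move: yw => /and3P[_ _]; lia.
  + by move: yw => /and3P[_ _]; lia.
  + by move/adj_hub: yw; rewrite (negPf nS0).
- case: (adj_nonhub (ltac:(lia) : 2 < n) vy) => [ey|[ey]|[ey _]]; subst y.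
  + by rewrite s1 //= s2 //; exact/adj_hub/adj_sym.
  + by move/adj_sym/adj_hub: yw; rewrite (negPf nS0).
  + by move: yw => /and3P[_ _]; have := @Sn n.-1; lia.
Qed.

(** Without these chords the hub is out of reach in two steps from [v], which lead only to [v - 2],
    [v], [v + 2]. Two steps from 0 miss these if [v >= 5]; for [v = 4] they may meet at 2, and the
    pair 3, 4 is used instead. *)
Lemma all_walks4_no3 v : 5 <= n -> all_walks n S 4 -> 4 <= v -> v + 4 <= n ->
  [|| S v.-1, S v | S v.+1].
Proof.
move=> n5 W4 v4 vn; apply: contraT; rewrite !negb_or => /and3P[Sa Sb Sc].
have nsp j : j + 3 <= n -> ~~ S j -> ~ spoke j.
  by move=> jn /negPf Sj; rewrite /spoke Sj /=; lia.
have N2 w y : adj n S v y -> adj n S y w -> [\/ w + 2 = v, w = v | w = v + 2].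
  move=> vy yw.
  case: (adj_nonhub (ltac:(lia) : v.+1 < n) vy) => [e|e|[e sp]]; last 1 first.
  - by case: (nsp v _ Sb sp); lia.
  - case: (adj_nonhub (ltac:(lia) : y.+1 < n) yw) => [f|f|[f sp]].
    + by constructor 3; lia.
    + by constructor 2; lia.
    + by case: (nsp y _ _ sp); [lia|rewrite e].
  - case: (adj_nonhub (ltac:(lia) : y.+1 < n) yw) => [f|f|[f sp]].
    + by constructor 2; lia.
    + by constructor 1; lia.
    + by case: (nsp y _ _ sp); [lia|rewrite -[y]/(y.+1.-1) -e].
have [ev|nev] := eqVneq v 4.
  rewrite {}ev /= in Sa Sb Sc N2 vn *.
  have [w [x [y [ux xw vy yw]]]] := walk4_mid (W4 3 4 ltac:(lia) ltac:(lia)).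
  have hw := N2 _ _ vy yw.
  case: (adj_nonhub (ltac:(lia) : 4 < n) ux) => [e|[e]|[e sp]]; last 1 first.
  - by case: (nsp 3 _ Sa sp); lia.
  - case: (adj_nonhub (ltac:(lia) : x.+1 < n) xw) => [f|f|[f sp]].
    + by case: hw; lia.
    + by case: hw; lia.
    + by case: (nsp x _ _ sp); [lia|rewrite e].
  - by case: hw; case: (adj_nonhub (ltac:(lia) : x.+1 < n) xw); lia.
have [w [x [y [ux xw vy yw]]]] := walk4_mid (W4 0 v ltac:(lia) ltac:(lia)).
have hw := N2 _ _ vy yw.
case: (adj_nonhub (ltac:(lia) : 1 < n) ux) => [e|//|[e]]; last first.
  by rewrite /spoke; case/orP=> [/Sn|]; lia.
by case: hw; case: (adj_nonhub (ltac:(lia) : x.+1 < n) xw); lia.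
Qed.

(* The case [a + 5 = n] is allowed: the hub [a + 4] is not a spoke. *)
Lemma all_walks4_no01010 a : all_walks n S 4 -> 0 < a ->
  a + 5 <= n -> [|| spoke a, spoke a.+2 | spoke (a + 4)].
Proof.
move=> W4 a0 an; apply: contraT => /norP[Sa /norP[Sb Sc]].
(* Two steps from [a.+2] end at [a], [a.+2], [a + 4] or the hub, none of them a spoke. Two steps
   from [a.+1] end at [a - 1], [a.+1], [a.+3] or, through the hub, at a spoke. *)
have [w [x [y [ux xw vy yw]]]] := walk4_mid (W4 a.+2 a.+1 ltac:(lia) ltac:(lia)).
have nhub : ~~ spoke n.-1.
  by rewrite /spoke negb_or; apply/andP; split; [apply/negP => /Sn; lia|lia].
have hw : [\/ w = a, w = a.+2, w = a + 4 | w = n.-1].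
  case: (adj_nonhub (ltac:(lia) : a.+3 < n) ux) => [e|e|[e sp]]; last 1 first.
  - by rewrite sp in Sb.
  - case: (adj_nonhub (ltac:(lia) : x.+1 < n) xw) => [f|f|[f _]].
    + by constructor 3; lia.
    + by constructor 2; lia.
    + by constructor 4.
  - case: (adj_nonhub (ltac:(lia) : x.+1 < n) xw) => [f|f|[f _]].
    + by constructor 2; lia.
    + by constructor 1; lia.
    + by constructor 4.
have nw : ~~ spoke w by case: hw => ->.
case: (adj_nonhub (ltac:(lia) : a.+2 < n) vy) => [e|[e]|[e _]]; subst y.
- case: (adj_nonhub (ltac:(lia) : a.+3 < n) yw); last by rewrite (negPf Sb) => -[].
    by case: hw; lia.
  by case: hw; lia.
- case: (adj_nonhub (ltac:(lia) : a.+1 < n) yw); last by rewrite (negPf Sa) => -[].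
    by case: hw; lia.
  by case: hw; lia.
- by move/adj_hub: yw; rewrite (negPf nw).
Qed.

End Walks.

(** * Symmetric companion matrices as graphs *)

(* [t] lists the last row from column 1 to column [n - 3], 0-based. *)
Definition chords (t : seq bool) : pred nat := nth false (false :: t).

(** In the last row, column 0 and the columns past [r] read [false]; for [r] of size [n - 2] this
    gives a_{n,1} = a_{n,n} = 0. *)
Definition companion_bit (n : nat) (r : seq bool) (i j : nat) : bool :=
  if i.+1 < n then j == i.+1 else nth false (false :: r) j.

Definition companion_of (R : realType) (n : nat) (r : seq bool) : 'M[R]_n :=
  (\matrix_(i, j) (companion_bit n r i j)%:R)%R.

Lemma chords_in_chords p (t : p.-tuple bool) : chords_in p.+3 (chords t).
Proof.
move=> j; rewrite /chords; case: j => [//|j] /= tj; split=> //.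
case: (ltnP j p) => [|pj]; first by lia.
by rewrite nth_default ?size_tuple in tj.
Qed.

Section Matrices.
Variable R : realType.
Local Open Scope ring_scope.

Lemma pos_expSP n (M : 'M[R]_n) k i j : nonneg_mx M ->
  0 < (M ^+ k.+1) i j <-> exists2 l, 0 < (M ^+ k) i l & 0 < M l j.
Proof.
move=> M0; have Mk0 l : nonneg_mx (M ^+ l).
  elim: l => [|l IH] a b; first by rewrite expr0 mxE; case: eqP.
  by rewrite exprSr mxE; apply: sumr_ge0 => c _; exact: mulr_ge0.
rewrite lt0r Mk0 andbT exprSr mxE psumr_neq0; last first.
  by move=> c _; apply: mulr_ge0; [exact: Mk0|exact: M0].
split.
  case/hasP => l _ /= hl; exists l; move: hl; rewrite lt0r mulf_eq0 negb_or.
    by case/andP => /andP[h _] _; rewrite lt0r h Mk0.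
  by case/andP => /andP[_ h] _; rewrite lt0r h M0.
case=> l h1 h2; apply/hasP; exists l; first by rewrite mem_index_enum.
by rewrite /= mulr_gt0.
Qed.

Lemma sym_companion_ofE n r (i j : 'I_n) :
  sym_companion (companion_of R n r) i j =
  (companion_bit n r i j + companion_bit n r j i)%:R.
Proof. by rewrite !mxE natrD. Qed.

Lemma sym_companion_of_gt0 p (t : p.-tuple bool) b (u v : 'I_p.+3) :
  (0 < sym_companion (companion_of R p.+3 (rcons t b)) u v)
  = adj p.+3 (chords t) u v.
Proof.
rewrite sym_companion_ofE ltr0n /adj !ltn_ord /= /companion_bit /chords.
have un := ltn_ord u; have vn := ltn_ord v.
move: (nat_of_ord u) (nat_of_ord v) un vn => {u v} u v un vn.
have nthE w : (w < p.+3)%N -> nth false (false :: rcons t b) w =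
    (nth false (false :: t) w) || (b && (w == p.+1)).
  case: w => [|w] wn /=; first by rewrite andbF.
  rewrite nth_rcons size_tuple eqSS; case: ltngtP => wp.
  - by rewrite andbF orbF.
  - by rewrite nth_default ?size_tuple ?andbF // ltnW.
  - by rewrite wp nth_default ?size_tuple ?andbT.
have nthp w : (p < w)%N -> nth false (false :: t) w = false.
  by case: w => // w pw; rewrite /= nth_default ?size_tuple.
rewrite !nthE //.
case: ifP => h1; case: ifP => h2; rewrite addn_gt0 !lt0b.
- lia.
- have -> : v = p.+2 by lia.
  by rewrite (nthp p.+2) //; move: (nth false (false :: t) u) => []; lia.
- have -> : u = p.+2 by lia.
  by rewrite (nthp p.+2) //; move: (nth false (false :: t) v) => []; lia.
- have [-> ->] : u = p.+2 /\ v = p.+2 by lia.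
  by rewrite !nthp //; lia.
Qed.

Lemma sym_companion_of_ge0 n r : nonneg_mx (sym_companion (companion_of R n r)).
Proof. by move=> i j; rewrite sym_companion_ofE ler0n. Qed.

Lemma pos_exp_walk p (t : p.-tuple bool) b k :
  pos_mx (sym_companion (companion_of R p.+3 (rcons t b)) ^+ k) <->
  all_walks p.+3 (chords t) k.
Proof.
set M := sym_companion _.
suff E (u v : 'I_p.+3) : 0 < (M ^+ k) u v <-> walk p.+3 (chords t) k u v.
  split=> [h u v un vn|h u v]; last by apply/E; exact: h.
  exact: (E (Ordinal un) (Ordinal vn)).1 (h _ _).
elim: k v => [|k IH] v.
  rewrite expr0 mxE /=; case: eqP => [->|ne]; first by rewrite ltr01.
  by rewrite ltxx; split=> // e; case: ne; exact: val_inj.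
apply: (iff_trans (pos_expSP _ _ _ (@sym_companion_of_ge0 _ _))).
split=> [[l /IH h]|[w h1 h2]].
  by rewrite sym_companion_of_gt0; exists l.
have wn : (w < p.+3)%N by case/and3P: h2.
exists (Ordinal wn); first exact/IH.
by rewrite sym_companion_of_gt0.
Qed.

Lemma companion_of_in00 p (t : p.-tuple bool) b :
  sym_companion00 (sym_companion (companion_of R p.+3 (rcons t b))).
Proof.
exists (companion_of R p.+3 (rcons t b)) => //; split=> [i j|].
  case: ifP => hi; rewrite !mxE /companion_bit hi //.
  by case: (nth _ _ _); [right|left].
split=> [i j ei ej|i ei]; rewrite !mxE /companion_bit ?ei ltnn ?ej //.
have -> : nat_of_ord i = p.+2 by lia.
by rewrite /= nth_default // size_rcons size_tuple.
Qed.

Lemma sym_companion00P p (M : 'M[R]_p.+3) : sym_companion00 M ->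
  exists t : p.-tuple bool, exists b,
    M = sym_companion (companion_of R p.+3 (rcons t b)).
Proof.
case=> A [cA [A0 An]] <-.
pose r j := A ord_max (inord j) == 1.
pose t := [tuple r (val i).+1 | i < p].
have nth_t k : (k < p)%N -> nth false t k = r k.+1.
  by move=> kp; rewrite -(tnth_nth false t (Ordinal kp)) tnth_mktuple.
exists t, (r p.+1); congr sym_companion.
apply/matrixP => i j; rewrite mxE /companion_bit.
have := cA i j; case: ifP => [//|hi] Aij.
have ei : i = ord_max by apply: val_inj => /=; have := ltn_ord i; lia.
have rj : A i j = (r j)%:R.
  rewrite /r -ei inord_val; case: Aij => ->; last by rewrite eqxx.
  by rewrite eq_sym oner_eq0.
case ej : (nat_of_ord j) => [|j'] /=; first by rewrite A0 // ei.
rewrite nth_rcons (size_tuple t); have jn := ltn_ord j; case: ltngtP => jp.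
- by rewrite rj ej nth_t.
- have eji : j = i by apply: val_inj; rewrite ei /=; lia.
  by rewrite eji An // ei.
- by rewrite rj ej jp.
Qed.

Lemma sym_companion_of_inj p (t t' : p.-tuple bool) b b' :
  sym_companion (companion_of R p.+3 (rcons t b)) =
  sym_companion (companion_of R p.+3 (rcons t' b')) -> t = t' /\ b = b'.
Proof.
move=> E.
suff er : rcons t b = rcons t' b'.
  by case/rcons_inj: er => /val_inj -> ->.
apply: (@eq_from_nth _ false); first by rewrite !size_rcons !size_tuple.
move=> j; rewrite size_rcons size_tuple => jp.
have jn : (j.+1 < p.+3)%N by lia.
(* In the last row the transpose adds the same path entry to both matrices, so it cancels. *)
have := congr1 (fun A : 'M[R]_p.+3 => A ord_max (Ordinal jn)) E.
rewrite /= !sym_companion_ofE => /eqP; rewrite eqr_nat /companion_bit /=.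
by rewrite ltnn; have -> : (j.+2 < p.+3)%N by [lia]; rewrite eqn_add2r;
  case: (nth _ _ _); case: (nth _ _ _).
Qed.

(* The factor 2 is the free entry [b] in column [p.+1]. *)
Lemma num_PSC00E p e :
  num_PSC00 R p.+3 e =
  (2 * #|[pred t : p.-tuple bool | `[< walk_exponent p.+3 (chords t) e >]]|)%N.
Proof.
set P := [pred t | _].
pose f (bt : bool * p.-tuple bool) : 'M[R]_p.+3 :=
  sym_companion (companion_of R p.+3 (rcons bt.2 bt.1)).
have expE b t : has_exponent (f (b, t)) e <-> walk_exponent p.+3 (chords t) e.
  split=> -[e0 pe emin]; split=> //.
  - exact/(pos_exp_walk t b).
  - by move=> k k0 /(pos_exp_walk t b); exact: emin.
  - exact/pos_exp_walk.
  - by move=> k k0 /pos_exp_walk; exact: emin.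
have f_inj : injective f.
  by move=> [b t] [b' t'] /sym_companion_of_inj[/= -> ->].
rewrite /num_PSC00.
have -> : fset_set [set M : 'M[R]_p.+3 | PSC00 M /\ has_exponent M e]%classic =
    [fset f x | x in [pred x : bool * p.-tuple bool | x.2 \in P]]%fset.
  apply/fsetP => M; rewrite in_fset_set; last exact: finite_PSC00_exponent.
  apply/idP/imfsetP; rewrite inE /=.
    case=> -[/sym_companion00P[t [b ->]] _] /(expE b t) h.
    by exists (b, t) => //; apply/asboolP.
  case=> -[b t] /= /asboolP h ->; split; last exact: (expE b t).2 h.
  split; first exact: companion_of_in00.
  split; first exact: sym_companion_of_ge0.
  by case: ((expE b t).2 h) => e0 pe _; exists e; split.
rewrite card_imfset //= -cardE -card_bool -cardX.
by apply: eq_card => -[b t]; rewrite !inE.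
Qed.
End Matrices.

(** * Binary strings *)

Local Notation zeros := (count negb).

(** Peeling off blocks 1, 01, 001 loses at most 2 zeros per 3 digits; the slack 2 pays for a final
    00. *)
Lemma zeros_no_000 (s : seq bool) :
  ~~ infix (nseq 3 false) s -> 3 * zeros s <= 2 * size s + 2.
Proof.
have [m] := ubnP (size s); elim: m s => // m IH s ms.
case: s ms => [|[] s] //=.
  by move=> ms hs; have := IH s ms hs; lia.
case: s => [|[] s] //=.
  by move=> ms hs; have := IH s (ltac:(lia)) hs; lia.
case: s => [|[] s] //=; last by rewrite prefix0s.
by move=> ms hs; have := IH s (ltac:(lia)) hs; lia.
Qed.

(** Peeling off blocks 1, 011, 01011 loses at most 2 zeros per 5 digits; the slack 4 pays for a
    final 010. *)
Lemma zeros_no_00_01010 (s : seq bool) : ~~ infix (nseq 2 false) s ->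
  ~~ infix [:: false; true; false; true; false] s ->
  5 * zeros s <= 2 * size s + 4.
Proof.
have [m] := ubnP (size s); elim: m s => // m IH s ms.
case: s ms => [|[] s] //=.
  by move=> ms h1 h2; have := IH s ms h1 h2; lia.
case: s => [|[] s] //=; last by rewrite prefix0s.
case: s => [|[] s] //=.
  by move=> ms h1 h2; have := IH s (ltac:(lia)) h1 h2; lia.
case: s => [|[] s] //=; last by rewrite prefix0s.
case: s => [|[] s] //=; last by rewrite prefix0s.
by move=> ms h1 h2; have := IH s (ltac:(lia)) h1 h2; lia.
Qed.

Lemma infix_nth (p s : seq bool) : infix p s ->
  exists2 a, a + size p <= size s
    & forall i, i < size p -> nth false s (a + i) = nth false p i.
Proof.
case/infixP => s1 [s2 ->]; exists (size s1).
  by rewrite !size_cat leq_add2l leq_addr.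
by move=> i ip; rewrite nth_cat ltnNge leq_addr /= addKn nth_cat ip.
Qed.

Lemma infix_nseqW (k l : nat) (s : seq bool) : k <= l ->
  infix (nseq l false) s -> infix (nseq k false) s.
Proof.
by move=> kl; rewrite -(subnKC kl) nseqD; exact: catr_infix.
Qed.

Lemma longest_zero_run_infix s : infix (nseq (longest_zero_run s) false) s.
Proof.
rewrite /longest_zero_run.
by apply: (big_ind (fun k => infix (nseq k false) s)) => [|k l|//];
  [exact: infix0s|rewrite /maxn; case: ifP].
Qed.

Lemma leq_longest_zero_run k s :
  (k <= longest_zero_run s) = infix (nseq k false) s.
Proof.
apply/idP/idP => [/infix_nseqW|h]; first by apply; exact: longest_zero_run_infix.
have ks : k < (size s).+1 by rewrite ltnS -(size_nseq k false) size_infix.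
by rewrite /longest_zero_run (bigD1 (Ordinal ks)) //= leq_maxl.
Qed.

Lemma longest_zero_run_zeros s : longest_zero_run s <= zeros s.
Proof.
have /infixW/(leq_count_subseq negb) := longest_zero_run_infix s.
by rewrite count_nseq mul1n.
Qed.

(* Concatenations of blocks 1 and 011 with total length [L]. *)
Fixpoint block_strings (L : nat) : seq (seq bool) :=
  match L with
  | 0 => [:: [::]]
  | 1 => [:: [:: true]]
  | 2 => [:: [:: true; true]]
  | (L'.+2 as L2).+1 =>
      map (cons true) (block_strings L2)
      ++ map (cat [:: false; true; true]) (block_strings L')
  end.

Lemma block_strings3 L : block_strings L.+3 =
  map (cons true) (block_strings L.+2)
  ++ map (cat [:: false; true; true]) (block_strings L).
Proof. by []. Qed.

Lemma block_strings_ind (P : nat -> Prop) :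
  P 0 -> P 1 -> P 2 -> (forall L, P L -> P L.+2 -> P L.+3) -> forall L, P L.
Proof.
move=> p0 p1 p2 pS L; suff: [/\ P L, P L.+1 & P L.+2] by case.
by elim: L => [|L [h0 h1 h2]]; split=> //; exact: pS.
Qed.

Lemma uniq_block_strings L : uniq (block_strings L).
Proof.
elim/block_strings_ind: L => // L u0 u2; rewrite block_strings3 cat_uniq.
apply/and3P; split.
- by rewrite map_inj_uniq // => s s' [].
- by apply/hasPn => _ /mapP[s _ ->]; apply/negP => /mapP[].
- by rewrite map_inj_uniq // => s s' [].
Qed.

(** With [q] blocks 011 there are [L - 2 * q] blocks in all, so the binomial chooses their places.
    The induction is Pascal's rule on the first block. *)
Lemma size_block_strings L B :
  \sum_(0 <= q < B) 'C(L - 2 * q, q) <= size (block_strings L).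
Proof.
elim/block_strings_ind: L B => [|||L IH0 IH2] B; last first.
  case: B => [|B]; first by rewrite big_geq.
  rewrite block_strings3 size_cat !size_map.
  apply: leq_trans (leq_add (IH2 B.+1) (IH0 B)).
  rewrite big_nat_recl // [X in _ <= X + _]big_nat_recl // !bin0 -addnA leq_add2l.
  rewrite -big_split /=; apply: leq_sum => q _.
  have -> : L - 2 * q = L.+2 - 2 * q.+1 by lia.
  have [h|h] := leqP (2 * q.+1) L.+2; first by rewrite subSn // binS.
  by have -> : L.+3 - 2 * q.+1 = 0 by lia; rewrite bin0n.
all: case: B => [|B]; first by rewrite big_geq.
all: rewrite big_nat_recl // bin0 big1_seq ?addn0 // => q _; rewrite bin_small //; lia.
Qed.

(** Each 0 is followed by 11 within its block. The last property feeds [all_walks4], with [i] and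
    [i.+2] standing for the two path neighbours of a vertex. *)
Lemma block_stringsP L s : s \in block_strings L ->
  [/\ size s = L,
      forall i, i < L -> L <= i + 2 -> nth false s i
    & forall i, i.+2 < L -> nth false s i || nth false s i.+2].
Proof.
elim/block_strings_ind: L s => [|||L IH0 IH2] s.
- by rewrite inE => /eqP ->.
- by rewrite inE => /eqP ->; split=> // -[].
- by rewrite inE => /eqP ->; split=> // -[|[]].
rewrite block_strings3 mem_cat => /orP[/mapP[s' /IH2[ss hl h2] ->]|].
  split=> [|[|i]|[|i]] //=; first by rewrite ss.
  - by move=> *; apply: hl.
  - exact: h2.
case/mapP=> s' /IH0[ss hl h2] ->; split=> [|[|[|[|i]]]|[|[|[|i]]]] //=.
- by rewrite ss.
- by move=> *; apply: hl.
- exact: h2.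
Qed.

(** * Counting *)

Lemma last_chord_onlyP p (t : p.+1.-tuple bool) :
  last_chord_only p.+4 (chords t) <-> t = [tuple of rcons (nseq p false) true].
Proof.
rewrite /last_chord_only !subSS subn0 /chords; split=> [[tp tl]|->] /=.
  apply/val_inj/(@eq_from_nth _ false); rewrite size_tuple.
    by rewrite size_rcons size_nseq.
  move=> i ip; rewrite nth_rcons size_nseq nth_nseq.
  case: (ltngtP i p) => [ip'|pi|->]; [|by lia|exact: tp].
  by case ti: (nth _ _ i) => //; have := tl i.+1 ti; lia.
split=> [|[|j]] //; first by rewrite /= nth_rcons size_nseq ltnn eqxx.
by rewrite /= nth_rcons size_nseq nth_nseq; case: ltngtP => // ->.
Qed.

Lemma card_walk_exponent_last p :
  #|[pred t : p.+1.-tuple bool |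
      `[< walk_exponent p.+4 (chords t) (2 * p.+4 - 4) >]]| = 1.
Proof.
have expP (t : p.+1.-tuple bool) :
    walk_exponent p.+4 (chords t) (2 * p.+4 - 4) <->
    t = [tuple of rcons (nseq p false) true].
  apply: iff_trans (last_chord_onlyP t).
  exact: walk_exponent_lastP (@chords_in_chords _ t) isT.
rewrite -[RHS](card1 [tuple of rcons (nseq p false) true]).
by apply: eq_card => t; rewrite !inE; apply/asboolP/eqP => /expP.
Qed.

(** Here [m] is [n - 5], the number of digits left once the chords at 1 and 2 are forced. *)
Definition walk4_strings m : pred (m.+2.-tuple bool) :=
  [pred t : m.+2.-tuple bool | `[< walk_exponent m.+2.+3 (chords t) 4 >]].

Lemma walk4_stringsP m (t : m.+2.-tuple bool) :
  reflect (all_walks m.+2.+3 (chords t) 4) (t \in @walk4_strings m).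
Proof.
rewrite inE; apply: (iffP (asboolP _)).
  exact: iffLR (walk_exponent4P (@chords_in_chords _ t) isT).
exact: iffRL (walk_exponent4P (@chords_in_chords _ t) isT).
Qed.

(** The appended digits belong to [n - 2], a spoke by the path, and to the hub, which is none. *)
Lemma spoke_chordsE m (s : seq bool) v : size s = m ->
  spoke m.+2.+3 (chords [:: true, true & s]) v.+3 =
  nth false (s ++ [:: true; false]) v.
Proof.
move=> sm; rewrite /spoke /chords /= nth_cat sm !eqSS.
case: ltngtP => vm; first by rewrite orbF.
  rewrite nth_default ?sm 1?ltnW //=.
  by case e: (v - m) => [|[|[]]] //; lia.
by rewrite vm subnn orbT.
Qed.

Lemma infix_nth2 (s : seq bool) i x y :
  i.+1 < size s -> nth false s i = x -> nth false s i.+1 = y ->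
  infix [:: x; y] s.
Proof.
move=> si <- <-; rewrite -{3}(cat_take_drop i s) (drop_nth false) 1?ltnW //.
by rewrite (drop_nth false) //; exact: (infix_infix _ [:: _; _]).
Qed.

Lemma walk4_strings_sub m (t : m.+2.-tuple bool) : t \in @walk4_strings m ->
  exists s : m.-tuple bool,
    [/\ tval t = [:: true, true & s], longest_zero_run s <= 2
      & longest_zero_run s <= 1 -> 5 * zeros s <= 2 * m + 3].
Proof.
move/walk4_stringsP => W4; have tS := @chords_in_chords _ t.
have [s ts] : exists s : m.-tuple bool, tval t = [:: true, true & s].
  have := all_walks4_start tS isT W4.
  case: t {W4 tS} => -[|x [|y s]] // st; rewrite /chords /= => /andP[-> ->].
  by exists (Tuple (st : size s == m)).
exists s; split=> //; rewrite ts in W4 tS.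
  rewrite leqNgt leq_longest_zero_run; apply/negP => /infix_nth[a].
  rewrite size_nseq size_tuple => am h.
  have := all_walks4_no3 tS isT W4 (ltac:(lia) : 4 <= a.+4) (ltac:(lia)).
  rewrite /chords /=.
  have := h 0 isT; have := h 1 isT; have := h 2 isT.
  by rewrite addn0 addn1 addn2 => /= -> -> ->.
move=> s1.
have no00 : ~~ infix (nseq 2 false) (s ++ [:: true; false]).
  apply/negP => /infix_nth[a]; rewrite size_cat size_tuple /= => am h.
  have := h 0 isT; have := h 1 isT; rewrite /= addn0 addn1 !nth_cat size_tuple.
  case: ltngtP => am1; last by rewrite am1 subnn.
    2: by have -> : a = m by [lia]; rewrite ?ltnn subnn.
  move=> h1 h0; move: s1.
  rewrite leqNgt leq_longest_zero_run => /negP; apply.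
  by apply: (infix_nth2 _ h0 h1); rewrite size_tuple.
have no01010 :
    ~~ infix [:: false; true; false; true; false] (s ++ [:: true; false]).
  apply/negP => /infix_nth[a]; rewrite size_cat size_tuple /= => am h.
  have := all_walks4_no01010 tS W4 (isT : 0 < a.+3) (ltac:(lia)).
  rewrite !addSn !spoke_chordsE ?size_tuple //.
  have := h 0 isT; have := h 2 isT; have := h 4 isT.
  by rewrite addn0 addn2 => -> -> ->.
(* The appended digits add one zero and two to the length:
   [5 * (zeros s + 1) <= 2 * (m + 2) + 4]. *)
have := zeros_no_00_01010 no00 no01010.
rewrite count_cat size_cat size_tuple /=; lia.
Qed.

Lemma leq_sum_nat_term (F : nat -> nat) a b i :
  a <= i < b -> F i <= \sum_(a <= j < b) F j.
Proof.
move=> ai; rewrite (bigD1_seq i) ?mem_index_iota ?iota_uniq //=.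
exact: leq_addr.
Qed.

Lemma card_sum_pred (T : finType) (A : pred T) : #|A| = \sum_(x : T) A x.
Proof.
rewrite -sum1_card big_mkcond; apply: eq_bigr => x _.
by rewrite unfold_in; case: (A x).
Qed.

Lemma sum_zero_run_strings m a b k :
  \sum_(a <= q < b) zero_run_strings m q k =
  \sum_(s : m.-tuple bool) \sum_(a <= q < b)
     ((count_mem false s == q) && (longest_zero_run s == k)).
Proof.
by rewrite exchange_big; apply: eq_bigr => q _; exact: card_sum_pred.
Qed.

(** Dropping the forced prefix 11 is injective. Longest zero runs 1 and 2 give the two sums, and the
    final 1 counts the string without zeros. *)
Lemma card_walk4_strings_le m B1 B2 :
  (forall q, 5 * q <= 2 * m + 3 -> q < B1) ->
  (forall q, 3 * q <= 2 * m + 2 -> q < B2) ->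
  #|@walk4_strings m| <= \sum_(1 <= q < B1) zero_run_strings m q 1
    + \sum_(2 <= q < B2) zero_run_strings m q 2 + 1.
Proof.
move=> hB1 hB2.
pose Q := [pred s : m.-tuple bool | (longest_zero_run s <= 2) &&
  ((longest_zero_run s <= 1) ==> (5 * zeros s <= 2 * m + 3))].
pose f (t : m.+2.-tuple bool) : m.-tuple bool :=
  [tuple of behead (behead t)].
have fP t : t \in @walk4_strings m -> tval t = [:: true, true & f t] /\ f t \in Q.
  move/walk4_strings_sub => [s [ts s2 s1]].
  have -> : f t = s by apply: val_inj; rewrite /= ts.
  by rewrite ts inE s2; split=> //; exact/implyP.
have f_inj : {in @walk4_strings m &, injective f}.
  move=> t t' /fP[e _] /fP[e' _] E; rewrite E in e.
  exact: val_inj (etrans e (esym e')).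
rewrite -(card_in_image f_inj).
apply: (@leq_trans #|Q|).
  by apply: subset_leq_card; apply/fintype.subsetP => _ /fintype.imageP[t /fP[_ h] ->].
have count_negb (s : m.-tuple bool) : count_mem false s = zeros s.
  by apply: eq_count => -[].
rewrite card_sum_pred !sum_zero_run_strings -big_split /=.
rewrite -[X in _ <= _ + X](card1 [tuple of nseq m true]) card_sum_pred -big_split /=.
apply: leq_sum => s _.
case sQ: (_ && _) => //; case/andP: sQ => s2 /implyP s1.
have zs := longest_zero_run_zeros s.
case ls: (longest_zero_run s) s1 s2 zs => [|[|[|l]]] // s1 _ zs.
- suff -> : s == [tuple of nseq m true] by rewrite addn1.
  have nz : false \notin s by rewrite -infix1s -(leq_longest_zero_run 1) ls.
  apply/eqP/val_inj/(@eq_from_nth _ false).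
    by rewrite !size_tuple.
  move=> i im; rewrite size_tuple in im; rewrite /= nth_nseq im.
  case si: (nth false s i) => //.
  by move: nz; rewrite -si mem_nth ?size_tuple.
- apply: leq_trans (leq_trans (leq_addr _ _) (leq_addr _ _)).
  have := @leq_sum_nat_term
    (fun q => (count_mem false s == q) && (1 == 1) : nat) 1 B1 (zeros s).
  by rewrite count_negb eqxx; apply; rewrite zs hB1 ?s1.
- apply: leq_trans (leq_trans (leq_addl _ _) (leq_addr _ _)).
  have := @leq_sum_nat_term
    (fun q => (count_mem false s == q) && (2 == 2) : nat) 2 B2 (zeros s).
  rewrite count_negb eqxx; apply; rewrite zs hB2 //.
  have := @zeros_no_000 s; rewrite size_tuple; apply.
  by rewrite -leq_longest_zero_run ls.
Qed.

(** A block string describes the vertices 3 to [n - 2]. Its last digit is always 1 and belongs to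
    [n - 2], so [take m] drops it without loss. *)
Lemma card_walk4_strings_ge m : size (block_strings m.+1) <= #|@walk4_strings m|.
Proof.
rewrite cardE -(size_map val) -(size_map (fun s => [:: true, true & take m s])).
apply: uniq_leq_size.
  rewrite map_inj_in_uniq ?uniq_block_strings // => s s' hs hs' [e].
  have lastP r : r \in block_strings m.+1 -> r = rcons (take m r) true.
    case/block_stringsP => sr lr _.
    rewrite -[true](lr m) ?addn2 // -take_nth ?sr //.
    by rewrite take_oversize ?sr.
  by rewrite (lastP s hs) (lastP s' hs') e.
move=> _ /mapP[s /block_stringsP[ss ls hs] ->].
have st : size [:: true, true & take m s] == m.+2.
  by rewrite /= size_take ss ltnSn.
apply/mapP; exists (Tuple st) => //; rewrite mem_enum; apply/walk4_stringsP.
have st' : size (take m s) = m by rewrite size_take ss ltnSn.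
have spE v : v <= m ->
    spoke m.+2.+3 (chords [:: true, true & take m s]) v.+3 = nth false s v.
  move=> vm; rewrite spoke_chordsE // nth_cat st'; case: ltngtP vm => // vm _.
    by rewrite nth_take.
  by rewrite vm subnn ls ?addn2.
(* Vertices 0 to 3 are next to 1 or 2; the neighbours of [v.+4] carry the digits [v] and [v.+2]. *)
apply: (all_walks4 (@chords_in_chords _ (Tuple st))) => // -[|[|[|[|v]]]] vm.
1-2: by left.
1-2: by right.
have [vm'|vm'] := ltnP v.+1 m.
  have := hs v (ltac:(lia)) => /orP[h|h]; [right|left].
    by rewrite spE //; lia.
  by rewrite -[v.+4.+1]/(v.+2.+3) spE.
by right; split=> //; rewrite spE ?ls //; lia.
Qed.

(* In the lower bound, truncated subtraction agrees with the convention that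
   'C(a, q) = 0 for a < q: when 2q + 4 > n (hence q >= 1, as n >= 5) the term
   is 'C(0, q) = 0. *)
Theorem theorem10 (R : realType) (n : nat) :
  ((4 <= n)%N -> num_PSC00 R n (2 * n - 4) = 2%N)
  /\
  ((5 <= n)%N ->
     (2 * \sum_(0 <= q < ((n + 1) %/ 3).+1) 'C(n - (2 * q + 4), q)
        <= num_PSC00 R n 4)%N
     /\
     (num_PSC00 R n 4
        <= 2 * (\sum_(1 <= q < ((2 * n - 7) %/ 5).+1)
                  zero_run_strings (n - 5) q 1
                + \sum_(2 <= q < ((2 * n + 2) %/ 3).+1)
                    zero_run_strings (n - 5) q 2
                + 1))%N).
Proof.
split.
  case: n => [|[|[|[|p]]]] // _.
  by rewrite (num_PSC00E R p.+1) card_walk_exponent_last.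
case: n => [|[|[|[|[|m]]]]] // _.
rewrite (num_PSC00E R m.+2) -/(@walk4_strings m) !leq_mul2l /=; split.
  apply: leq_trans (card_walk4_strings_ge m).
  apply: leq_trans (size_block_strings _ ((m.+2.+3 + 1) %/ 3).+1).
  by apply: leq_sum => q _; rewrite addnC subnDA.
have -> : m.+2.+3 - 5 = m by rewrite -addn2 -addn3 -addnA addnK.
(* For [m = n - 5] the first bound [2 * m + 3] is exactly [2 * n - 7]; the second,
   [2 * m + 2 = 2 * n - 8], is below [2 * n + 2]. *)
by apply: card_walk4_strings_le => q; lia.
Qed.
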